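(* An almost contact metric structure $(F,\xi,\eta,g)$ on a $(2n+1)$-dimensional manifold $M$ is $\alpha$-Sasakian (for some differentiable function $\alpha$ on $M$) if and only if it is a structure of the class $\mathbf C_6$.
   Context: An almost contact metric structure on $M$, $\dim M=2n+1$, consists of a Riemannian metric $g=\langle\,,\rangle$, a unit vector field $\xi$, the 1-form $\eta(X)=\langle X,\xi\rangle$, and a $(1,1)$ tensor field $F$ with $F\xi=0$, preserving $V=\xi^\perp$, with $F^2=-I$ on $V$ and $\langle FX,FY\rangle=\langle X,Y\rangle$ for $X,Y\in V$. $\nabla$ is the Riemannian connection and $\Phi(X,Y)=\langle X,FY\rangle$. The structure is $\alpha$-Sasakian if $(\nabla_XF)Y=\alpha\{\langle X,Y\rangle\xi-\eta(Y)X\}$ for all vector fields $X,Y$, where $\alpha$ is a differentiable function on $M$. It is of class $\mathbf C_6$ if for all $X,Y,Z$ $$(\nabla_X\Phi)(Y,Z)=\tfrac1{2n}[\langle X,Z\rangle\eta(Y)-\langle X,Y\rangle\eta(Z)]\,\delta\Phi(\xi),$$ where $\delta\Phi(X)=-\sum_{i=1}^n[(\nabla_{E_i}\Phi)(E_i,X)+(\nabla_{FE_i}\Phi)(FE_i,X)]-(\nabla_\xi\Phi)(\xi,X)$ for a local orthonormal basis $E_1,\dots,E_n,FE_1,\dots,FE_n,\xi$. *)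

(* Defs.v *)
From HB Require Import structures.
From mathcomp Require Import all_boot all_order all_algebra.
From mathcomp Require Import all_classical all_reals all_analysis.
Import Order.TTheory GRing.Theory Num.Theory.
Import numFieldNormedType.Exports.

Set Implicit Arguments.
Unset Strict Implicit.
Unset Printing Implicit Defensive.

Local Open Scope classical_set_scope.
Local Open Scope ring_scope.

(* C^k regularity on an open set U: f is C^(k+1) iff it is Frechet            *)
(* differentiable on U and x |-> df_x(v) is C^k on U for every fixed v.       *)
Fixpoint ck (R : realType) (V W : normedModType R) (k : nat) (U : set V)
    (f : V -> W) : Prop :=
  if k is k'.+1 then
    (forall x, U x -> differentiable f x) /\
    (forall v, ck k' U (fun x => 'D_v f x))
  else forall x, U x -> {for x, continuous f}.

Definition cinfty (R : realType) (V W : normedModType R) (U : set V)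
    (f : V -> W) : Prop :=
  forall k, ck k U f.

(* Charts are total functions; only their restriction to chart_dom i is       *)
(* meaningful, with inverse chart_inv i defined on the open set chart_cod i.  *)
Record manifold (R : realType) (d : nat) := Manifold {
  carrier :> topologicalType ;
  manifold_hausdorff : hausdorff_space carrier ;
  manifold_second_countable : @second_countable carrier ;
  chart_index : Type ;
  chart_dom : chart_index -> set carrier ;
  chart_cod : chart_index -> set 'rV[R]_d ;
  chart : chart_index -> carrier -> 'rV[R]_d ;
  chart_inv : chart_index -> 'rV[R]_d -> carrier ;
  chart_dom_open : forall i, open (chart_dom i) ;
  chart_cod_open : forall i, open (chart_cod i) ;
  chart_fun : forall i p, chart_dom i p -> chart_cod i (chart i p) ;
  chart_inv_fun : forall i x, chart_cod i x -> chart_dom i (chart_inv i x) ;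
  chartK : forall i p, chart_dom i p -> chart_inv i (chart i p) = p ;
  chart_invK : forall i x, chart_cod i x -> chart i (chart_inv i x) = x ;
  chart_continuous : forall i p, chart_dom i p -> {for p, continuous (chart i)} ;
  chart_inv_continuous :
    forall i x, chart_cod i x -> {for x, continuous (chart_inv i)} ;
  chart_cover : forall p, exists i, chart_dom i p ;
  chart_transition : forall i j,
    cinfty [set x | chart_cod i x /\ chart_dom j (chart_inv i x)]
           (fun x => chart j (chart_inv i x))
}.

Section Fields.
Context {R : realType} {d : nat} {M : manifold R d}.

(* T_pM is identified with R^d through the chart chart_at p; hence a (not     *)
(* necessarily smooth) vector field is a function M -> 'rV[R]_d whose value   *)
(* at p is expressed in the coordinates chart_at p.  As chart_at p jumps with *)
(* p, smoothness of fields is NOT smoothness of these components.             *)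
Definition chart_at (p : M) : chart_index M := projT1 (cid (chart_cover p)).

Definition vfield := M -> 'rV[R]_d.

Definition smooth_fun (U : set M) (f : M -> R) : Prop :=
  forall i, cinfty (W := R^o)
    [set x | chart_cod i x /\ U (chart_inv i x)] (fun x => f (chart_inv i x)).

(* X f; by the chain rule any chart around p would give the same value.       *)
Definition lie_derive (X : vfield) (f : M -> R) : M -> R := fun p =>
  'D_(X p) ((fun x => f (chart_inv (chart_at p) x)) : 'rV[R]_d -> R^o)
    (chart (chart_at p) p).

Definition smooth_vfield (U : set M) (X : vfield) : Prop :=
  forall (V : set M) (f : M -> R), open V -> V `<=` U ->
    smooth_fun V f -> smooth_fun V (lie_derive X f).

(* A (0,2) tensor g and a (1,1) tensor F are given at p by their matrices in  *)
(* the coordinates chart_at p, acting on row vectors.                         *)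
Definition inner (g : M -> 'M[R]_d) (X Y : vfield) : M -> R :=
  fun p => (X p *m g p *m (Y p)^T) 0 0.

Definition tapp (F : M -> 'M[R]_d) (X : vfield) : vfield :=
  fun p => X p *m F p.

Definition smooth_tensor02 (g : M -> 'M[R]_d) : Prop :=
  forall (U : set M) (X Y : vfield), open U ->
    smooth_vfield U X -> smooth_vfield U Y -> smooth_fun U (inner g X Y).

Definition smooth_tensor11 (F : M -> 'M[R]_d) : Prop :=
  forall (U : set M) (X : vfield), open U ->
    smooth_vfield U X -> smooth_vfield U (tapp F X).

Record riemannian_metric (g : M -> 'M[R]_d) : Prop := {
  metric_smooth : smooth_tensor02 g ;
  metric_sym : forall p, (g p)^T = g p ;
  metric_pos : forall p (v : 'rV[R]_d), v != 0 -> 0 < (v *m g p *m v^T) 0 0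
}.

(* D X Y stands for nabla_X Y.  It is a connection on all open subsets at     *)
(* once: it is local, so that it acts on fields that are only defined (and    *)
(* smooth) on an open set U, such as those of a local frame.  The values      *)
(* outside U of a field on U are junk.                                        *)
Record levi_civita (g : M -> 'M[R]_d) (D : vfield -> vfield -> vfield) : Prop := {
  lc_smooth : forall (U : set M) X Y, open U ->
    smooth_vfield U X -> smooth_vfield U Y -> smooth_vfield U (D X Y) ;
  lc_local : forall (U : set M) X X' Y Y', open U ->
    smooth_vfield U X -> smooth_vfield U Y ->
    {in U, X =1 X'} -> {in U, Y =1 Y'} -> {in U, D X Y =1 D X' Y'} ;
  lc_addl : forall (U : set M) X X' Y, open U ->
    smooth_vfield U X -> smooth_vfield U X' -> smooth_vfield U Y ->
    {in U, forall p, D (fun q => X q + X' q) Y p = D X Y p + D X' Y p} ;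
  lc_scalel : forall (U : set M) f X Y, open U -> smooth_fun U f ->
    smooth_vfield U X -> smooth_vfield U Y ->
    {in U, forall p, D (fun q => f q *: X q) Y p = f p *: D X Y p} ;
  lc_addr : forall (U : set M) X Y Y', open U ->
    smooth_vfield U X -> smooth_vfield U Y -> smooth_vfield U Y' ->
    {in U, forall p, D X (fun q => Y q + Y' q) p = D X Y p + D X Y' p} ;
  lc_leibniz : forall (U : set M) f X Y, open U -> smooth_fun U f ->
    smooth_vfield U X -> smooth_vfield U Y ->
    {in U, forall p, D X (fun q => f q *: Y q) p
                     = lie_derive X f p *: Y p + f p *: D X Y p} ;
  lc_metric : forall (U : set M) X Y Z, open U ->
    smooth_vfield U X -> smooth_vfield U Y -> smooth_vfield U Z ->
    {in U, forall p, lie_derive X (inner g Y Z) p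
                     = inner g (D X Y) Z p + inner g Y (D X Z) p} ;
  (* (D X Y - D Y X) f = [X, Y] f *)
  lc_torsion_free : forall (U : set M) X Y f, open U ->
    smooth_vfield U X -> smooth_vfield U Y -> smooth_fun U f ->
    {in U, forall p, lie_derive (fun q => D X Y q - D Y X q) f p
                     = lie_derive X (lie_derive Y f) p
                       - lie_derive Y (lie_derive X f) p}
}.

Record almost_contact_metric (F : M -> 'M[R]_d) (xi : vfield)
    (g : M -> 'M[R]_d) : Prop := {
  acm_metric : riemannian_metric g ;
  acm_xi_smooth : smooth_vfield setT xi ;
  acm_F_smooth : smooth_tensor11 F ;
  acm_xi_unit : forall p, inner g xi xi p = 1 ;
  acm_F_xi : forall p, tapp F xi p = 0 ;
  acm_F_V : forall X p, inner g X xi p = 0 -> inner g (tapp F X) xi p = 0 ;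
  acm_F_sq : forall X p, inner g X xi p = 0 -> tapp F (tapp F X) p = - X p ;
  acm_F_isometry : forall X Y p, inner g X xi p = 0 -> inner g Y xi p = 0 ->
    inner g (tapp F X) (tapp F Y) p = inner g X Y p
}.

Definition eta (g : M -> 'M[R]_d) (xi X : vfield) : M -> R := inner g X xi.

Definition Phi (F g : M -> 'M[R]_d) (X Y : vfield) : M -> R :=
  inner g X (tapp F Y).

(* (nabla_X F) Y *)
Definition nablaF (D : vfield -> vfield -> vfield) (F : M -> 'M[R]_d)
    (X Y : vfield) : vfield :=
  fun p => D X (tapp F Y) p - tapp F (D X Y) p.

(* (nabla_X Phi)(Y, Z) *)
Definition nablaPhi (D : vfield -> vfield -> vfield) (F g : M -> 'M[R]_d)
    (X Y Z : vfield) : M -> R :=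
  fun p => lie_derive X (Phi F g Y Z) p
           - Phi F g (D X Y) Z p - Phi F g Y (D X Z) p.

(* Vector fields range over those defined on open subsets (U = setT gives the *)
(* global ones); the condition is tensorial, hence local.                     *)
Definition alpha_sasakian (D : vfield -> vfield -> vfield)
    (F : M -> 'M[R]_d) (xi : vfield) (g : M -> 'M[R]_d) (alpha : M -> R) : Prop :=
  forall (U : set M) (X Y : vfield), open U ->
    smooth_vfield U X -> smooth_vfield U Y ->
    forall p, U p ->
      nablaF D F X Y p = alpha p *: (inner g X Y p *: xi p - eta g xi Y p *: X p).

End Fields.

Arguments vfield {R d} M.

Section ClassC6.
Context {R : realType} {n : nat} {M : manifold R n.*2.+1}.
Variables (D : vfield M -> vfield M -> vfield M).
Variables (F : M -> 'M[R]_(n.*2.+1)) (xi : vfield M) (g : M -> 'M[R]_(n.*2.+1)).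

(* E_1, ..., E_n, F E_1, ..., F E_n, xi is an orthonormal frame on U; being   *)
(* 2n+1 orthonormal vectors they form a basis at each point of U.             *)
Definition adapted_frame (U : set M) (E : 'I_n -> vfield M) : Prop :=
  (forall i, smooth_vfield U (E i)) /\
  forall p, U p ->
    [/\ forall i j, inner g (E i) (E j) p = (i == j)%:R,
        forall i j, inner g (tapp F (E i)) (tapp F (E j)) p = (i == j)%:R,
        forall i j, inner g (E i) (tapp F (E j)) p = 0,
        forall i, inner g (E i) xi p = 0 /\ inner g (tapp F (E i)) xi p = 0 &
        inner g xi xi p = 1].

Definition deltaPhi_frame (E : 'I_n -> vfield M) (X : vfield M) : M -> R :=
  fun p => - (\sum_(i < n) (nablaPhi D F g (E i) (E i) X p
                 + nablaPhi D F g (tapp F (E i)) (tapp F (E i)) X p))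
           - nablaPhi D F g xi xi X p.

(* The value at p does not depend on the local frame: pick any around p.      *)
Definition deltaPhi (X : vfield M) : M -> R := fun p =>
  xget 0 [set r | exists (U : set M) (E : 'I_n -> vfield M),
    [/\ open U, U p, adapted_frame U E & r = deltaPhi_frame E X p]].

Definition class_C6 : Prop :=
  forall (U : set M) (X Y Z : vfield M), open U ->
    smooth_vfield U X -> smooth_vfield U Y -> smooth_vfield U Z ->
    forall p, U p ->
      nablaPhi D F g X Y Z p =
      (n.*2%:R)^-1 * (inner g X Z p * eta g xi Y p - inner g X Y p * eta g xi Z p)
      * deltaPhi xi p.

End ClassC6.

(* Main.v *)
Require Import Defs.
From mathcomp Require Import all_boot all_order all_algebra.
From mathcomp Require Import all_classical all_reals all_analysis.
From mathcomp Require Import ring.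
Import Order.TTheory GRing.Theory Num.Theory.
Import numFieldNormedType.Exports.
Set Implicit Arguments.
Unset Strict Implicit.
Unset Printing Implicit Defensive.
Local Open Scope classical_set_scope.
Local Open Scope ring_scope.

(** Metric compatibility of the connection turns the covariant derivative of
    the fundamental form into that of F ([nablaPhiE]):
      (nabla_X Phi)(Y, Z) = <Y, (nabla_X F) Z>.
    So the alpha-Sasakian identity, paired with an arbitrary field Y, reads
      (nabla_X Phi)(Y, Z) = alpha (<X, Z> eta(Y) - <X, Y> eta(Z)),
    which is the C6 identity with alpha in place of delta Phi(xi) / 2n, and
    everything amounts to matching these two functions.

    If the structure is alpha-Sasakian, every term (nabla_E Phi)(E, xi) with E
    a unit field orthogonal to xi equals -alpha, and the term of xi vanishes;
    summing over any adapted frame gives delta Phi(xi) = 2n alpha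
    ([sasakian_deltaPhi]).  Since [deltaPhi] takes the value 0 at a point that
    has no adapted frame around it, the existence of such frames has to be
    proved ([adapted_frame_exists]).

    Conversely, in class C6 put alpha = delta Phi(xi) / 2n.  The pairing of
    (nabla_X F) Y with every tangent vector is then the expected one, and
    nondegeneracy of the metric gives the alpha-Sasakian identity.  For the
    smoothness of alpha, a unit field E orthogonal to xi on an open set gives
    alpha = - (nabla_E Phi)(E, xi) there, by C6 itself.

    Both directions need smooth local fields.  A constant vector in a chart
    defines a smooth field with a prescribed value at a point
    ([smooth_vfield_extension]); its smoothness rests on the chain rule for
    maps of class C^k ([ck_comp]) applied to the transition maps.  Adapted
    frames come from the Gram-Schmidt process ([orthonormal_extension]),
    carried out two vectors E, FE at a time ([partial_frame_exists]). *)

(** * Maps of class C^k between normed spaces *)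

Section Calculus.
Context {R : realType} {V : normedModType R}.

Lemma near_eq_differentiable (W : normedModType R) (f h : V -> W) (x : V) :
  (\forall y \near x, f y = h y) -> differentiable f x -> differentiable h x.
Proof.
move=> fh df.
have fhx : f x = h x by exact: nbhs_singleton fh.
have [dc e] := (diff_locallyP x f).1 df.
have e' : h \o shift x = cst (h x) + 'd f x +o_ 0 id.
  apply/eqaddoP => eps eps0.
  have /eqaddoP/(_ eps eps0) fo : f \o shift x = cst (f x) + 'd f x +o_ 0 id by [].
  have fh' : \forall y \near 0, f (y + x) = h (y + x).
    by move: fh; rewrite (near_shift 0) /=; apply: filterS => y /=; rewrite subr0.
  near=> y.
  have E : (h \o shift x - (cst (h x) + 'd f x)) y =
           (f \o shift x - (cst (f x) + 'd f x)) y.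
    by rewrite /= !fctE /= fhx (near fh').
  by rewrite E; near: y.
have dE := diff_unique dc e'.
by apply/diff_locallyP; rewrite dE; split.
Unshelve. all: by end_near. Qed.

Lemma open_near_eq (W : Type) (U : set V) (f h : V -> W) x : open U -> U x ->
  (forall y, U y -> f y = h y) -> \forall y \near x, f y = h y.
Proof.
move=> oU Ux fh; have : \forall y \near x, U y by exact: open_nbhs_nbhs.
by apply: filterS.
Qed.

Lemma ck_continuous (W : normedModType R) k (U : set V) (f : V -> W) x :
  ck k U f -> U x -> {for x, continuous f}.
Proof.
case: k => [|k] /=; first by move=> h; exact: h.
by move=> [h _] Ux; apply: differentiable_continuous; exact: h.
Qed.

Lemma ck_le (W : normedModType R) k (U : set V) (f : V -> W) :
  ck k.+1 U f -> ck k U f.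
Proof.
elim: k f => [|k IH] f fk; first by move=> x; exact: ck_continuous fk.
by case: fk => df fk; split=> // v; apply: IH; exact: fk.
Qed.

Lemma ck_subset (W : normedModType R) k (U U' : set V) (f : V -> W) :
  U' `<=` U -> ck k U f -> ck k U' f.
Proof.
move=> sU; elim: k f => [|k IH] f; first by move=> cf x /sU; exact: cf.
by move=> [df fk]; split=> [x /sU|v]; [exact: df | exact/IH/fk].
Qed.

(** Passing to the derivatives D_v f keeps the neighbourhoods A fixed, so the
    local hypothesis propagates through the induction on k. *)
Lemma ck_local (W : normedModType R) k (U : set V) (f : V -> W) :
  (forall x, U x -> exists A : set V, A x /\ ck k A f) -> ck k U f.
Proof.
elim: k f => [|k IH] f H; first by move=> x /H[A [Ax cf]]; exact: cf.
split=> [x /H[A [Ax [df _]]]|v]; first exact: df.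
by apply: IH => x /H[A [Ax [_ fk]]]; exists A; split => //; exact: fk.
Qed.

Lemma ck_eq (W : normedModType R) k (U : set V) (f h : V -> W) :
  open U -> (forall x, U x -> f x = h x) -> ck k U f -> ck k U h.
Proof.
move=> oU; elim: k f h => [|k IH] f h fh.
  move=> cf x Ux; have nfh := open_near_eq oU Ux fh.
  rewrite /prop_for /continuous_at -(fh x Ux).
  by apply: cvg_trans (cf x Ux); exact: near_eq_cvg.
move=> [df fk]; split=> [x Ux|v].
  exact: near_eq_differentiable (open_near_eq oU Ux fh) (df x Ux).
apply: (IH _ _ _ (fk v)) => x Ux.
exact/near_eq_derive/(open_near_eq oU Ux fh).
Qed.

Lemma ck_cst (W : normedModType R) k (U : set V) (c : W) : ck k U (fun=> c).
Proof.
elim: k c => [|k IH] c; first by move=> x _; exact: cst_continuous.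
split=> [x _|v]; first exact: differentiable_cst.
have -> : (fun x => 'D_v (fun=> c) x) = (fun=> 0).
  by apply/funext => x; exact: derive_cst.
exact: IH.
Qed.

Lemma ckD (W : normedModType R) k (U : set V) (f h : V -> W) : open U ->
  ck k U f -> ck k U h -> ck k U (fun x => f x + h x).
Proof.
move=> oU; elim: k f h => [|k IH] f h.
  by move=> cf ch x Ux; apply: cvgD; [exact: cf | exact: ch].
move=> [df fk] [dh hk]; split=> [x Ux|v].
  by apply: differentiableD; [exact: df | exact: dh].
apply: (ck_eq oU _ (IH _ _ (fk v) (hk v))) => x Ux.
by rewrite [RHS]deriveD //; apply: diff_derivable; [exact: df | exact: dh].
Qed.

Lemma ckM k (U : set V) (f h : V -> R^o) : open U ->
  ck k U f -> ck k U h -> ck k U (fun x => f x * h x : R^o).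
Proof.
move=> oU; elim: k f h => [|k IH] f h.
  by move=> cf ch x Ux; apply: cvgM; [exact: cf | exact: ch].
move=> fk hk; have [df dfk] := fk; have [dh dhk] := hk; split=> [x Ux|v].
  by apply: differentiableM; [exact: df | exact: dh].
have fh := IH _ _ (ck_le fk) (dhk v); have hf := IH _ _ (ck_le hk) (dfk v).
apply: (ck_eq oU _ (ckD oU fh hf)) => x Ux.
by rewrite [RHS]deriveM //; apply: diff_derivable; [exact: df | exact: dh].
Qed.

Lemma ck_sum (W : normedModType R) k (U : set V) (m : nat) (f : 'I_m -> V -> W) :
  open U -> (forall i, ck k U (f i)) -> ck k U (fun x => \sum_i f i x).
Proof.
move=> oU; elim: m f => [|m IH] f fk.
  by under eq_fun do rewrite big_ord0; exact: ck_cst.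
by under eq_fun do rewrite big_ord_recl; apply: ckD => //; exact: IH.
Qed.

Lemma ck_coord k (U : set V) (m : nat) (f : V -> 'rV[R]_m) (j : 'I_m) :
  open U -> ck k U f -> ck k U (fun x => f x 0 j : R^o).
Proof.
move=> oU; elim: k f => [|k IH] f.
  move=> cf x Ux; apply: (@continuous_comp _ _ _ f (fun M => M 0 j : R^o)).
    exact: cf.
  exact: coord_continuous.
move=> [df fk]; split=> [x Ux|v].
  apply: (@differentiable_comp _ _ _ _ f (fun M => M 0 j : R^o)); first exact: df.
  exact: differentiable_coord.
apply: (ck_eq oU _ (IH _ (fk v))) => x Ux.
by rewrite derive_mx ?mxE //; apply: diff_derivable; exact: df.
Qed.

Lemma derive_comp_rV m (f : V -> 'rV[R]_m) (h : 'rV[R]_m -> R^o) x v :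
  differentiable f x -> differentiable h (f x) ->
  'D_v (fun y => h (f y)) x = 'D_('D_v f x) h (f x).
Proof.
move=> df dh; rewrite !deriveE //; last exact: differentiable_comp.
by rewrite (diff_comp df dh).
Qed.

(** In finite dimension the partial derivatives determine the differential.
    This reduces C^k regularity of a composite to sums and products. *)
Lemma derive_rVE m (h : 'rV[R]_m -> R^o) (x v : 'rV[R]_m) : differentiable h x ->
  'D_v h x = \sum_j v 0 j * 'D_(delta_mx 0 j) h x.
Proof.
move=> dh; rewrite deriveE // [in LHS](row_sum_delta v) linear_sum /=.
by apply: eq_bigr => j _; rewrite linearZ /= deriveE.
Qed.

(** The derivative of h o f along v is the sum over j of (D_v f)_j times
    (D_(e_j) h) o f, whose factors are C^k by induction when f and h are
    C^(k+1). *)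
Lemma ck_comp k m (U : set V) (A : set 'rV[R]_m) (f : V -> 'rV[R]_m)
    (h : 'rV[R]_m -> R^o) : open U -> (forall x, U x -> A (f x)) ->
  ck k U f -> ck k A h -> ck k U (fun x => h (f x)).
Proof.
move=> oU sA; elim: k h => [|k IH] h.
  move=> cf ch x Ux; apply: continuous_comp; first exact: cf.
  exact/ch/sA.
move=> fk hk; have [df dfk] := fk; have [dh dhk] := hk; split=> [x Ux|v].
  by apply: differentiable_comp; [exact: df | exact/dh/sA].
have H : ck k U (fun x => \sum_(j < m)
    (('D_v f x) 0 j * 'D_(delta_mx 0 j) h (f x)) : R^o).
  apply: ck_sum => // j; apply: ckM => //; first exact: (ck_coord j oU (dfk v)).
  by apply: (IH (fun y => 'D_(delta_mx 0 j) h y)); [exact: ck_le fk | exact: dhk].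
apply: (ck_eq oU _ H) => x Ux.
rewrite derive_comp_rV ?derive_rVE //; by [exact: df | exact/dh/sA].
Qed.

(** The inverse square root r of f satisfies D_v r = - r^3 D_v f / 2, a
    polynomial in r and D_v f, so that an induction on k closes on itself. *)
Lemma ck_rsqrt k (U : set V) (f : V -> R^o) : open U ->
  (forall x, U x -> 0 < f x) -> ck k U f ->
  ck k U (fun x => (Num.sqrt (f x))^-1 : R^o).
Proof.
move=> oU f0; have s0 x : U x -> Num.sqrt (f x) != 0.
  by move=> /f0 ?; rewrite sqrtr_eq0 -ltNge.
elim: k => [|k IH] fk.
  move=> x Ux; apply: cvgV; first exact: s0.
  apply: (@continuous_comp _ _ _ f (@Num.sqrt R)); first exact: fk.
  exact: sqrt_continuous.
have [df dfk] := fk.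
have ds x : U x -> is_derive (f x : R^o) 1 (@Num.sqrt R : R^o -> R^o) (2 * Num.sqrt (f x))^-1.
  by move=> /f0; exact: is_derive1_sqrt.
have dif x : U x -> differentiable (@Num.sqrt R : R^o -> R^o) (f x).
  by move=> Ux; apply/derivable1_diffP; have [] := ds _ Ux.
have dsf x : U x -> differentiable (fun y => Num.sqrt (f y) : R^o) x.
  by move=> Ux; apply: (@differentiable_comp _ _ _ _ f (@Num.sqrt R : R^o -> R^o));
    [exact: df | exact: dif].
split=> [x Ux|v]; first by apply: differentiableV => //; [exact: dsf | exact: s0].
have r := IH (ck_le fk).
have H : ck k U (fun x => - 2^-1 * ((Num.sqrt (f x))^-1 * ((Num.sqrt (f x))^-1
    * ((Num.sqrt (f x))^-1 * 'D_v f x))) : R^o).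
  apply: ckM => //; first exact: ck_cst.
  exact: (ckM oU r (ckM oU r (ckM oU r (dfk v)))).
apply: (ck_eq oU _ H) => x Ux.
have -> : 'D_v (fun y => (Num.sqrt (f y))^-1 : R^o) x =
   - (Num.sqrt (f x)) ^- 2 *: 'D_v (fun y => Num.sqrt (f y) : R^o) x.
  by apply: deriveV; [exact: s0 | apply/diff_derivable/dsf].
have dE w : 'd (@Num.sqrt R : R^o -> R^o) (f x) w = w * (2 * Num.sqrt (f x))^-1.
  have [_ <-] := ds _ Ux; rewrite (deriveE _ (dif _ Ux)).
  by rewrite -[w in LHS]mulr1 -[X in 'd _ _ X]/(w *: (1 : R^o)) linearZ.
have -> : 'D_v (fun y => Num.sqrt (f y) : R^o) x = 'D_v f x * (2 * Num.sqrt (f x))^-1.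
  rewrite deriveE; last exact: dsf.
  rewrite (@diff_comp _ _ _ _ f (@Num.sqrt R : R^o -> R^o) x (df _ Ux) (dif _ Ux)) /=.
  by rewrite dE deriveE //; exact: df.
have E (a b c : R) : - c * (a * (a * (a * b))) = - a ^+ 2 * (b * (c * a)) by ring.
by rewrite -[RHS]/(_ * _) -exprVn invfM; exact: E.
Qed.

End Calculus.

(** * Smooth functions and vector fields on a manifold *)

Section ManifoldCalculus.
Context {R : realType} {d : nat} {M : manifold R d}.
Implicit Types (U : set M) (f h : M -> R) (X Y : vfield M).

Lemma open_in_chart U i : open U ->
  open [set x | chart_cod (m := M) i x /\ U (chart_inv i x)].
Proof.
move=> oU; rewrite openE => x [cx Ux].
have nU : nbhs (chart_inv i x) U by exact: open_nbhs_nbhs.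
have n1 : \forall y \near x, chart_cod i y.
  by apply: open_nbhs_nbhs; split => //; exact: chart_cod_open.
have n2 : \forall y \near x, U (chart_inv i y) by exact: chart_inv_continuous nU.
by near=> y; split; near: y.
Unshelve. all: by end_near. Qed.

Lemma smooth_fun_subset U U' f : U' `<=` U -> smooth_fun U f -> smooth_fun U' f.
Proof. by move=> sU sf i k; apply: ck_subset (sf i k) => x [? /sU]. Qed.

Lemma smooth_fun_local U f :
  (forall p, U p -> exists A : set M, A p /\ smooth_fun A f) -> smooth_fun U f.
Proof.
move=> H i k; apply: ck_local => x [cx /H[A [Ax sA]]].
by exists [set x | chart_cod i x /\ A (chart_inv i x)]; split=> //; exact: sA.
Qed.

Lemma smooth_fun_eq U f h : open U -> (forall p, U p -> f p = h p) ->
  smooth_fun U f -> smooth_fun U h.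
Proof.
move=> oU fh sf i k; apply: ck_eq (sf i k); first exact: open_in_chart.
by move=> x [_ /fh].
Qed.

Lemma smooth_fun_cst U (c : R) : smooth_fun U (fun=> c).
Proof. by move=> i k; exact: (@ck_cst _ _ R^o). Qed.

Lemma smooth_funD U f h : open U -> smooth_fun U f -> smooth_fun U h ->
  smooth_fun U (fun p => f p + h p).
Proof.
by move=> oU sf sh i k; apply: ckD; [exact: open_in_chart|exact: sf|exact: sh].
Qed.

Lemma smooth_funM U f h : open U -> smooth_fun U f -> smooth_fun U h ->
  smooth_fun U (fun p => f p * h p).
Proof.
by move=> oU sf sh i k; apply: ckM; [exact: open_in_chart|exact: sf|exact: sh].
Qed.

Lemma smooth_funN U f : open U -> smooth_fun U f -> smooth_fun U (fun p => - f p).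
Proof.
move=> oU sf; apply: (smooth_fun_eq oU _ (smooth_funM oU (smooth_fun_cst U (-1)) sf)).
by move=> p _; rewrite mulN1r.
Qed.

Lemma smooth_fun_rsqrt U f : open U -> (forall p, U p -> 0 < f p) ->
  smooth_fun U f -> smooth_fun U (fun p => (Num.sqrt (f p))^-1).
Proof.
move=> oU f0 sf i k; apply: ck_rsqrt; [exact: open_in_chart| |exact: sf].
by move=> x [_ /f0].
Qed.

Lemma smooth_fun_diff U f i p : smooth_fun U f -> U p -> chart_dom i p ->
  differentiable ((fun x => f (chart_inv i x)) : 'rV[R]_d -> R^o) (chart i p).
Proof.
move=> sf Up dp; have [df _] := sf i 1; apply: df; split.
  exact: chart_fun.
by rewrite chartK.
Qed.

Lemma chart_at_dom (p : M) : chart_dom (chart_at p) p.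
Proof. exact: (projT2 (cid (chart_cover p))). Qed.

Lemma smooth_fun_continuous U f p : open U -> smooth_fun U f -> U p ->
  {for p, continuous f}.
Proof.
move=> oU sf Up; set i := chart_at p; have dp : chart_dom i p := chart_at_dom p.
have c1 : {for p, continuous ((fun x => f (chart_inv i x)) \o chart i)}.
  apply: continuous_comp; first exact: chart_continuous.
  by apply: differentiable_continuous; exact: smooth_fun_diff sf Up dp.
rewrite /prop_for /continuous_at -[in X in _ --> X](chartK dp).
apply: cvg_trans c1; apply: near_eq_cvg.
have : \forall q \near p, chart_dom i q.
  by apply: open_nbhs_nbhs; split => //; exact: chart_dom_open.
by apply: filterS => q dq /=; rewrite chartK.
Qed.

Lemma open_smooth_fun_gt0 U f : open U -> smooth_fun U f ->
  open [set p | U p /\ 0 < f p].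
Proof.
move=> oU sf; rewrite openE => p [Up fp].
have n1 : \forall q \near p, U q by exact: open_nbhs_nbhs.
have n2 : \forall q \near p, 0 < f q.
  exact: (cvgr_gt _ (smooth_fun_continuous oU sf Up)) fp.
by near=> q; split; near: q.
Unshelve. all: by end_near. Qed.

Lemma lie_deriveD U X Y f p : smooth_fun U f -> U p ->
  lie_derive (fun q => X q + Y q) f p = lie_derive X f p + lie_derive Y f p.
Proof.
move=> sf Up; have df := smooth_fun_diff sf Up (chart_at_dom p).
by rewrite /lie_derive !deriveE // linearD.
Qed.

Lemma lie_deriveZ U (a : M -> R) X f p : smooth_fun U f -> U p ->
  lie_derive (fun q => a q *: X q) f p = a p * lie_derive X f p.
Proof.
move=> sf Up; have df := smooth_fun_diff sf Up (chart_at_dom p).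
by rewrite /lie_derive !deriveE // linearZ.
Qed.

Lemma smooth_vfield_subset U U' X : U' `<=` U -> smooth_vfield U X -> smooth_vfield U' X.
Proof. by move=> sU sX V f oV sV; apply: sX => // p /sV /sU. Qed.

Lemma smooth_vfieldD U X Y : smooth_vfield U X -> smooth_vfield U Y ->
  smooth_vfield U (fun q => X q + Y q).
Proof.
move=> sX sY V f oV sV sf.
apply: (smooth_fun_eq oV _ (smooth_funD oV (sX V f oV sV sf) (sY V f oV sV sf))).
by move=> p Vp; rewrite (lie_deriveD X Y sf Vp).
Qed.

Lemma smooth_vfieldZ U (a : M -> R) X : smooth_fun U a -> smooth_vfield U X ->
  smooth_vfield U (fun q => a q *: X q).
Proof.
move=> sa sX V f oV sV sf; have sa' := smooth_fun_subset sV sa.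
apply: (smooth_fun_eq oV _ (smooth_funM oV sa' (sX V f oV sV sf))).
by move=> p Vp; rewrite (lie_deriveZ a X sf Vp).
Qed.

Lemma smooth_vfield0 U : smooth_vfield U (fun=> 0).
Proof.
move=> V f oV sV sf; rewrite (_ : lie_derive _ f = fun=> 0); first exact: smooth_fun_cst.
by apply/funext => p; exact: derive0.
Qed.

Lemma smooth_vfield_sum U (I : Type) (s : seq I) (X : I -> vfield M) :
  (forall i, smooth_vfield U (X i)) ->
  smooth_vfield U (fun q => \sum_(i <- s) X i q).
Proof.
move=> sX; elim: s => [|i s IH].
  by under eq_fun do rewrite big_nil; exact: smooth_vfield0.
by under eq_fun do rewrite big_cons; exact: smooth_vfieldD.
Qed.

(** The coordinate field of chart i with constant components v.  The chain rule
    through the transition map converts v to the coordinates [chart_at q] in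
    which a field is expressed at q. *)
Definition chart_field (i : chart_index M) (v : 'rV[R]_d) : vfield M := fun q =>
  'D_v (fun x => chart (chart_at q) (chart_inv i x)) (chart i q).

Lemma transition_diff i j q : chart_dom i q -> chart_dom j q ->
  differentiable (fun x => chart (m := M) j (chart_inv i x)) (chart i q).
Proof.
move=> di dj; have [dt _] := chart_transition i j 1; apply: dt; split => /=.
  exact: chart_fun.
by rewrite chartK.
Qed.

(** The jumps of [chart_at q] cancel: the field differentiates f as the constant
    vector v does in the single chart i. *)
Lemma lie_derive_chart_field i v U f q : open U -> smooth_fun U f -> U q ->
  chart_dom i q ->
  lie_derive (chart_field i v) f q =
  'D_v ((fun x => f (chart_inv i x)) : 'rV[R]_d -> R^o) (chart i q).
Proof.
move=> oU sf Uq dq; rewrite /lie_derive /chart_field; set j := chart_at q.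
have dj : chart_dom j q := chart_at_dom q.
have := @derive_comp_rV _ _ _ (fun x => chart j (chart_inv i x))
  (fun x => f (chart_inv j x)) (chart i q) v (transition_diff dq dj).
rewrite chartK // => <-; last exact: smooth_fun_diff sf Uq dj.
apply: near_eq_derive.
have : \forall x \near chart i q, chart_cod i x /\ chart_dom j (chart_inv i x).
  apply: open_nbhs_nbhs; split; first exact/open_in_chart/chart_dom_open.
  by split; [exact: chart_fun | rewrite chartK].
by apply: filterS => x [_ djx]; rewrite chartK.
Qed.

Lemma smooth_chart_field i v : smooth_vfield (chart_dom i) (chart_field i v).
Proof.
move=> V f oV sV sf j k.
have oA := open_in_chart (i := j) oV.
have T := chart_transition j i k.
have H : ck k [set x | chart_cod j x /\ V (chart_inv j x)]
   (fun x => 'D_v ((fun y => f (chart_inv i y)) : 'rV[R]_d -> R^o)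
                  (chart i (chart_inv j x)) : R^o).
  apply: (@ck_comp _ _ k d _ [set x | chart_cod i x /\ V (chart_inv i x)]
    (fun x => chart i (chart_inv j x))
    (fun z => 'D_v ((fun y => f (chart_inv i y)) : 'rV[R]_d -> R^o) z)) => //.
  - by move=> x [cx Vx]; split; [exact/chart_fun/sV | rewrite chartK //; exact: sV].
  - by apply: ck_subset T => x [cx /sV].
  - by have [_] := sf i k.+1; exact.
apply: (ck_eq oA _ H) => x [cx Vx].
by rewrite (lie_derive_chart_field v oV sf Vx) //; exact: sV.
Qed.

(** At p itself the coordinate change is the identity, so the coordinate field
    takes exactly the prescribed value. *)
Lemma smooth_vfield_extension (p : M) (v : 'rV[R]_d) :
  exists U X, [/\ open U, U p, smooth_vfield U X & X p = v].
Proof.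
exists (chart_dom (chart_at p)), (chart_field (chart_at p) v); split.
- exact: chart_dom_open.
- exact: chart_at_dom.
- exact: smooth_chart_field.
rewrite /chart_field.
rewrite -[RHS](@derive_id _ _ (chart (chart_at p) p) v); apply: near_eq_derive.
have : \forall x \near chart (chart_at p) p, chart_cod (chart_at p) x.
  apply: open_nbhs_nbhs; split; first exact: chart_cod_open.
  exact/chart_fun/chart_at_dom.
by apply: filterS => x cx; rewrite chart_invK.
Qed.

End ManifoldCalculus.

(** * Bilinear forms on row vectors *)

Section Dot.
Context {R : realType} {d : nat}.
Implicit Types (G : 'M[R]_d) (u v w : 'rV[R]_d).

Definition dot G u v : R := (u *m G *m v^T) 0 0.

Lemma dotDl G u v w : dot G (u + v) w = dot G u w + dot G v w.
Proof. by rewrite /dot !mulmxDl mxE. Qed.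

Lemma dotZl G a u w : dot G (a *: u) w = a * dot G u w.
Proof. by rewrite /dot -!scalemxAl mxE. Qed.

Lemma dotC G u v : G^T = G -> dot G u v = dot G v u.
Proof.
move=> sG; rewrite /dot -[in LHS](trmxK (u *m G *m v^T)) mxE.
by rewrite !trmx_mul trmxK sG mulmxA.
Qed.

Lemma dotNl G u w : dot G (- u) w = - dot G u w.
Proof. by rewrite -scaleN1r dotZl mulN1r. Qed.

Lemma dotBr G u v w : dot G w (u - v) = dot G w u - dot G w v.
Proof. by rewrite /dot linearB mulmxBr !mxE. Qed.

Lemma dotZr G a u w : dot G w (a *: u) = a * dot G w u.
Proof. by rewrite /dot linearZ -scalemxAr mxE. Qed.

Lemma dotNr G u w : dot G w (- u) = - dot G w u.
Proof. by rewrite -scaleN1r dotZr mulN1r. Qed.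

Lemma dot_suml G (I : Type) (s : seq I) (e : I -> 'rV[R]_d) w :
  dot G (\sum_(i <- s) e i) w = \sum_(i <- s) dot G (e i) w.
Proof.
elim: s => [|i s IH]; first by rewrite !big_nil /dot !mul0mx mxE.
by rewrite !big_cons dotDl IH.
Qed.

Lemma dot_project (T : finType) G (e : T -> 'rV[R]_d) w t :
  (forall s t, dot G (e s) (e t) = (s == t)%:R) ->
  dot G (w - \sum_s dot G w (e s) *: e s) (e t) = 0.
Proof.
move=> oe; rewrite dotDl dotNl dot_suml (bigD1 t) //= big1 => [|s st].
  by rewrite dotZl oe eqxx mulr1 addr0 subrr.
by rewrite dotZl oe (negPf st) mulr0.
Qed.

(** Fewer than d linear conditions on d unknowns have a nonzero solution. *)
Lemma exists_orthogonal (T : finType) G (e : T -> 'rV[R]_d) : (#|T| < d)%N ->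
  exists2 v, v != 0 & forall t, dot G v (e t) = 0.
Proof.
move=> Td; pose B := \matrix_(a < d, j < #|T|) (G *m (e (enum_val j))^T) a 0.
exists (nz_row (kermx B)).
  rewrite nz_row_eq0 -mxrank_eq0 mxrank_ker subn_eq0 -ltnNge.
  exact: leq_ltn_trans (rank_leq_col B) Td.
have /sub_kermxP vB : (nz_row (kermx B) <= kermx B)%MS by exact: nz_row_sub.
move=> t; have /rowP/(_ (enum_rank t)) := vB; rewrite !mxE => vBt.
rewrite /dot -mulmxA mxE -[RHS]vBt; apply: eq_bigr => a _.
by rewrite [B _ _]mxE enum_rankK.
Qed.

End Dot.

(** * Orthonormal extension of a local frame *)

Section Extension.
Context {R : realType} {d : nat} {M : manifold R d}.
Context (g : M -> 'M[R]_d) (rg : riemannian_metric g).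

(** One Gram-Schmidt step with smooth dependence on the point.  Starting from a
    field W whose value at p is already orthogonal to the frame, the projected
    field Y still has the value W p <> 0 at p, hence can be normalised on a
    neighbourhood. *)
Lemma orthonormal_extension (T : finType) (U : set M) (e : T -> vfield M) p :
  (#|T| < d)%N -> open U -> U p -> (forall t, smooth_vfield U (e t)) ->
  (forall q, U q -> forall s t, inner g (e s) (e t) q = (s == t)%:R) ->
  exists (U' : set M) (N : vfield M), [/\ open U', U' p, U' `<=` U, smooth_vfield U' N &
    forall q, U' q -> inner g N N q = 1 /\ forall t, inner g N (e t) q = 0].
Proof.
move=> Td oU Up se oe.
have [v v0 ve] := exists_orthogonal (g p) (fun t => e t p) Td.
have [A [W [oA Ap sW Wp]]] := smooth_vfield_extension p v.
pose B := U `&` A.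
have oB : open B by exact: openI.
have sB t : smooth_vfield B (e t) by apply: smooth_vfield_subset (se t) => q [].
have sBW : smooth_vfield B W by apply: smooth_vfield_subset sW => q [].
pose Y : vfield M := fun q => W q + (-1) *: \sum_s inner g W (e s) q *: e s q.
have sY : smooth_vfield B Y.
  apply: smooth_vfieldD => //; apply: smooth_vfieldZ; first exact: smooth_fun_cst.
  apply: smooth_vfield_sum => t; apply: smooth_vfieldZ => //.
  exact: metric_smooth.
have Ye q t : B q -> inner g Y (e t) q = 0.
  move=> [Uq _]; rewrite -[LHS]/(dot (g q) (Y q) (e t q)) /Y scaleN1r.
  exact: (dot_project (e := fun t => e t q) _ _ (oe q Uq)).
have Yp : Y p = v.
  rewrite /Y big1 ?scaler0 ?addr0 // => t _.
  by rewrite -[inner _ _ _ _]/(dot _ _ _) Wp ve scale0r.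
have sYY : smooth_fun B (inner g Y Y) by exact: metric_smooth.
pose U' := [set q | B q /\ 0 < inner g Y Y q].
have oU' : open U' by exact: open_smooth_fun_gt0.
have U'B : U' `<=` B by move=> q [].
exists U', (fun q => (Num.sqrt (inner g Y Y q))^-1 *: Y q); split=> //.
- by split; [split | rewrite /inner Yp; exact: metric_pos].
- by move=> q [[]].
- apply: smooth_vfieldZ; last exact: smooth_vfield_subset sY.
  by apply: smooth_fun_rsqrt => //; [move=> q [] | exact: smooth_fun_subset sYY].
move=> q [Bq Y0]; split=> [|t].
  rewrite -[LHS]/(dot (g q) (_ *: Y q) (_ *: Y q)) dotZl dotZr.
  rewrite -[dot _ _ _]/(inner g Y Y q) mulrA -expr2 exprVn sqr_sqrtr ?ltW //.
  by rewrite mulVf // gt_eqF.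
by rewrite -[LHS]/(dot (g q) (_ *: Y q) _) dotZl -[dot _ _ _]/(inner g Y (e t) q) Ye ?mulr0.
Qed.

Lemma inner_nondegenerate p (w : 'rV[R]_d) :
  (forall v, dot (g p) v w = 0) -> w = 0.
Proof.
move=> vw; apply/eqP; apply: contraT => /(metric_pos rg p).
by rewrite -/(dot (g p) w w) vw ltxx.
Qed.

End Extension.

(** * Almost contact metric structures and adapted frames *)

Section ContactAlgebra.
Context {R : realType} {d : nat} {M : manifold R d}.
Context (F : M -> 'M[R]_d) (xi : vfield M) (g : M -> 'M[R]_d).
Context (acm : almost_contact_metric F xi g).

Let rg := acm_metric acm.

Lemma innerC (X Y : vfield M) p : inner g X Y p = inner g Y X p.
Proof. exact: (dotC _ _ (Defs.metric_sym rg p)). Qed.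

(** <FX, FFY> = <X, FY> by isometry, and FFY = - Y. *)
Lemma tapp_skew (X Y : vfield M) p : inner g X xi p = 0 -> inner g Y xi p = 0 ->
  inner g (tapp F X) Y p = - inner g X (tapp F Y) p.
Proof.
move=> Xx Yx; have := acm_F_isometry acm Xx (acm_F_V acm Yx).
rewrite -[LHS]/(dot (g p) (tapp F X p) (tapp F (tapp F Y) p)) (acm_F_sq acm Yx) dotNr.
by move=> <-; rewrite opprK.
Qed.

Lemma tapp_orthogonal (X : vfield M) p : inner g X xi p = 0 ->
  inner g X (tapp F X) p = 0.
Proof.
move=> Xx; have := tapp_skew Xx Xx; rewrite innerC => /eqP.
by rewrite -addr_eq0 -mulr2n mulrn_eq0 /= => /eqP.
Qed.

(** The relations that make xi, E_i, F E_i (i < k) orthonormal, up to those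
    that follow from the properties of F on the orthogonal of xi. *)
Definition partial_frame (k : nat) (U : set M) (E : nat -> vfield M) :=
  (forall i, (i < k)%N -> smooth_vfield U (E i)) /\
  forall q, U q -> [/\ forall i, (i < k)%N -> inner g (E i) xi q = 0,
    forall i j, (i < k)%N -> (j < k)%N -> inner g (E i) (E j) q = (i == j)%:R &
    forall i j, (i < k)%N -> (j < k)%N -> inner g (E i) (tapp F (E j)) q = 0].

(** If N is a unit field orthogonal to xi, E_i and F E_i, then F N is orthogonal
    to all of these and to N, since F is skew and isometric on the orthogonal
    of xi.  So N can be taken as the next field of the frame as long as the
    2k + 1 previous fields do not fill the tangent space. *)
Lemma partial_frame_exists p k : (k.*2 < d)%N ->
  exists (U : set M) (E : nat -> vfield M), [/\ open U, U p & partial_frame k U E].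
Proof.
elim: k => [|k IH] kd.
  by exists setT, (fun _ _ => 0); split; [exact: openT | by [] | split].
have kd' : ((k.*2).+1 < d)%N by rewrite (leq_trans _ kd) // doubleS.
have [U [E [oU Up [sE oE]]]] := IH (ltnW kd').
pose e (t : option ('I_k + 'I_k)) : vfield M :=
  match t with
  | None => xi
  | Some (inl i) => E i
  | Some (inr i) => tapp F (E i)
  end.
have se t : smooth_vfield U (e t).
  case: t => [[i|i]|] /=; first exact: sE.
  - exact/(acm_F_smooth acm)/sE.
  - exact: smooth_vfield_subset (acm_xi_smooth acm).
have oe q : U q -> forall s t, inner g (e s) (e t) q = (s == t)%:R.
  move=> Uq; have [Ex EE EF] := oE q Uq.
  move=> [[i|i]|] [[j|j]|] /=; rewrite ?(Ex, EE, EF) //.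
  - by rewrite innerC EF.
  - by rewrite (acm_F_isometry acm) ?Ex ?EE.
  - by rewrite (acm_F_V acm) ?Ex.
  - by rewrite innerC Ex.
  - by rewrite innerC (acm_F_V acm) ?Ex.
  - exact: (acm_xi_unit acm).
have Tk : (#|{: option ('I_k + 'I_k)}| < d)%N.
  by rewrite card_option card_sum card_ord addnn.
have [U' [N [oU' U'p sU sN oN]]] := orthonormal_extension rg Tk oU Up se oe.
exists U', (fun i => if i == k then N else E i); split=> //; split=> [i|q U'q].
  rewrite ltnS leq_eqVlt; case: (i == k) => //= ik.
  exact: smooth_vfield_subset (sE i ik).
have [Ex EE EF] := oE q (sU _ U'q).
have [NN Ne] := oN q U'q.
have Nx : inner g N xi q = 0 := Ne None.
have NE i : (i < k)%N -> inner g N (E i) q = 0.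
  by move=> ik; exact: (Ne (Some (inl (Ordinal ik)))).
have NF i : (i < k)%N -> inner g N (tapp F (E i)) q = 0.
  by move=> ik; exact: (Ne (Some (inr (Ordinal ik)))).
have ltk i : (i < k.+1)%N = (i == k) || (i < k)%N by rewrite ltnS leq_eqVlt.
split=> [i|i j|i j]; rewrite !ltk.
- by case: eqP => //= _ ik; exact: Ex.
- case: (eqVneq i k) => [->|ik] /=.
    by case: (eqVneq j k) => [->|jk] _ //= jk'; rewrite ?eqxx // NE // eq_sym (negPf jk).
  case: (eqVneq j k) => [->|jk] /= ik' jk'; last exact: EE.
  by rewrite innerC NE // (negPf ik).
- case: (eqVneq i k) => [_|_] /=; case: (eqVneq j k) => [_|_] /= ik jk.
  + exact: tapp_orthogonal.
  + exact: NF.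
  + by rewrite innerC tapp_skew ?Ex ?NF ?oppr0.
  + exact: EF.
Qed.

(** Metric compatibility expands X <Y, FZ> into <nabla_X Y, FZ> +
    <Y, nabla_X (FZ)>, and the first term cancels. *)
Lemma nablaPhiE (D : vfield M -> vfield M -> vfield M) (U : set M)
    (X Y Z : vfield M) p : levi_civita g D -> open U ->
  smooth_vfield U X -> smooth_vfield U Y -> smooth_vfield U Z -> U p ->
  nablaPhi D F g X Y Z p = inner g Y (nablaF D F X Z) p.
Proof.
move=> lc oU sX sY sZ Up.
have sFZ := acm_F_smooth acm oU sZ.
rewrite /nablaPhi /Phi (lc_metric lc oU sX sY sFZ) ?inE //.
rewrite -[inner g Y (nablaF D F X Z) p]/(dot (g p) (Y p) (D X (tapp F Z) p - tapp F (D X Z) p)).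
by rewrite dotBr [inner g (D X Y) _ p + _]addrC addrK.
Qed.

Lemma smooth_nablaPhi (D : vfield M -> vfield M -> vfield M) (U : set M)
    (X Y Z : vfield M) : levi_civita g D -> open U ->
  smooth_vfield U X -> smooth_vfield U Y -> smooth_vfield U Z ->
  smooth_fun U (nablaPhi D F g X Y Z).
Proof.
move=> lc oU sX sY sZ.
have sFZ := acm_F_smooth acm oU sZ.
have sP : smooth_fun U (lie_derive X (Phi F g Y Z)).
  by apply: (sX U) => //; exact: metric_smooth.
have sT (X' Y' : vfield M) : smooth_vfield U X' -> smooth_vfield U Y' ->
    smooth_fun U (fun p => - inner g X' Y' p).
  by move=> sX' sY'; apply: smooth_funN => //; exact: metric_smooth.
have sXY : smooth_vfield U (D X Y) by exact: (lc_smooth lc).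
have sFXZ : smooth_vfield U (tapp F (D X Z)).
  exact/(acm_F_smooth acm)/(lc_smooth lc).
exact: (smooth_funD oU (smooth_funD oU sP (sT _ _ sXY sFZ)) (sT _ _ sY sFXZ)).
Qed.

End ContactAlgebra.

(** * The alpha-Sasakian condition and the class C6 *)

Section Sasakian.
Context {R : realType} {n : nat} {M : manifold R n.*2.+1}.
Context (F : M -> 'M[R]_(n.*2.+1)) (xi : vfield M) (g : M -> 'M[R]_(n.*2.+1)).
Context (D : vfield M -> vfield M -> vfield M).
Context (acm : almost_contact_metric F xi g) (lc : levi_civita g D).

Lemma adapted_frame_exists p : exists (U : set M) (E : 'I_n -> vfield M),
  [/\ open U, U p & adapted_frame F xi g U E].
Proof.
have [U [E [oU Up [sE oE]]]] := partial_frame_exists acm p (ltnSn n.*2).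
exists U, (fun i : 'I_n => E i); split => //; split=> [i|q Uq]; first exact: sE.
have [Ex EE EF] := oE q Uq.
split=> [i j|i j|i j|i|]; last exact: (acm_xi_unit acm).
- exact: EE.
- by rewrite (acm_F_isometry acm) ?Ex ?EE.
- exact: EF.
- by rewrite (acm_F_V acm) ?Ex.
Qed.

Lemma sasakian_nablaPhi (alpha : M -> R) (U : set M) (X Y Z : vfield M) p :
  alpha_sasakian D F xi g alpha -> open U ->
  smooth_vfield U X -> smooth_vfield U Y -> smooth_vfield U Z -> U p ->
  nablaPhi D F g X Y Z p =
  alpha p * (inner g X Z p * eta g xi Y p - inner g X Y p * eta g xi Z p).
Proof.
move=> sas oU sX sY sZ Up; rewrite (nablaPhiE acm lc oU) //.
rewrite -[LHS]/(dot (g p) (Y p) (nablaF D F X Z p)) (sas U) // dotZr dotBr !dotZr.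
rewrite [dot (g p) (Y p) (X p)](dotC _ _ (Defs.metric_sym (acm_metric acm) p)).
by congr (_ * (_ - _)); rewrite mulrC.
Qed.

(** Each of the 2n terms of the frame orthogonal to xi contributes alpha, and xi
    contributes 0, whichever adapted frame is chosen. *)
Lemma sasakian_deltaPhi (alpha : M -> R) p : alpha_sasakian D F xi g alpha ->
  deltaPhi D F xi g xi p = n.*2%:R * alpha p.
Proof.
move=> sas; rewrite /deltaPhi; case: xgetP => [_ _ [U [E [oU Up [sE oE] ->]]]|none].
  have [EE FF _ Ex xx] := oE p Up.
  have sx : smooth_vfield U xi by exact: smooth_vfield_subset (acm_xi_smooth acm).
  have sF i : smooth_vfield U (tapp F (E i)) by exact: (acm_F_smooth acm oU (sE i)).
  rewrite /deltaPhi_frame (sasakian_nablaPhi sas oU) // !(subrr, mulr0) subr0.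
  rewrite (eq_bigr (fun=> - (alpha p *+ 2))) => [|i _].
    by rewrite sumrN opprK sumr_const card_ord -mulrnA mul2n mulr_natl.
  rewrite (sasakian_nablaPhi sas oU (sE i) (sE i) sx Up).
  rewrite (sasakian_nablaPhi sas oU (sF i) (sF i) sx Up) EE FF !eqxx /eta xx.
  by have [-> ->] := Ex i; rewrite mulr0 sub0r mulr1 mulrN1 mulr2n opprD.
have [U [E [oU Up fE]]] := adapted_frame_exists p.
by case: (none (deltaPhi_frame D F xi g E xi p)); exists U, E.
Qed.

End Sasakian.

Theorem proposition7p4 (R : realType) (n : nat) (n_gt0 : (0 < n)%N)
    (M : manifold R n.*2.+1)
    (F : M -> 'M[R]_(n.*2.+1)) (xi : vfield M) (g : M -> 'M[R]_(n.*2.+1))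
    (acm : almost_contact_metric F xi g)
    (D : vfield M -> vfield M -> vfield M) (lc : levi_civita g D) :
  (exists alpha : M -> R,
     smooth_fun setT alpha /\ alpha_sasakian D F xi g alpha)
  <-> class_C6 D F xi g.
Proof.
have n2 : n.*2%:R != 0 :> R by rewrite pnatr_eq0 double_eq0 -lt0n.
split=> [[alpha [_ sas]] U X Y Z oU sX sY sZ p Up|c6].
  rewrite (sasakian_nablaPhi acm lc sas oU) // (sasakian_deltaPhi acm lc p sas).
  by rewrite [RHS]mulrAC mulKf.
pose alpha p := (n.*2%:R)^-1 * deltaPhi D F xi g xi p.
have c6a U X Y Z p : open U -> smooth_vfield U X -> smooth_vfield U Y ->
    smooth_vfield U Z -> U p -> nablaPhi D F g X Y Z p =
    alpha p * (inner g X Z p * eta g xi Y p - inner g X Y p * eta g xi Z p).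
  by move=> oU sX sY sZ Up; rewrite (c6 U) // /alpha mulrAC.
exists alpha; split.
  (* By C6, alpha is locally minus the derivative of Phi along one frame field. *)
  apply: smooth_fun_local => p _.
  have [U [E [oU Up [sE oE]]]] := adapted_frame_exists acm p.
  exists U; split=> //; pose E0 := E (Ordinal n_gt0).
  have sx : smooth_vfield U xi by exact: smooth_vfield_subset (acm_xi_smooth acm).
  have sP := smooth_nablaPhi acm lc oU (sE (Ordinal n_gt0)) (sE (Ordinal n_gt0)) sx.
  apply: (smooth_fun_eq oU _ (smooth_funN oU sP)) => q Uq.
  have [EE _ _ Ex xx] := oE q Uq.
  rewrite (c6a U _ _ _ q oU (sE _) (sE _) sx Uq) EE eqxx /eta xx; have [-> _] := Ex (Ordinal n_gt0).
  by rewrite !mulr0 sub0r mulr1 mulrN1 opprK.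
(* Test the vector identity at p against a field W with arbitrary value at p. *)
move=> U X Y oU sX sY p Up; apply/eqP; rewrite -subr_eq0; apply/eqP.
apply: (inner_nondegenerate (acm_metric acm) (p := p)) => v.
have [A [W [oA Ap sW Wp]]] := smooth_vfield_extension p v.
pose B := U `&` A; have oB : open B by exact: openI.
have sub Z : smooth_vfield U Z -> smooth_vfield B Z.
  by apply: smooth_vfield_subset => q [].
have sBW : smooth_vfield B W by apply: smooth_vfield_subset sW => q [].
rewrite -Wp dotBr -[dot _ _ (nablaF _ _ _ _ _)]/(inner g W (nablaF D F X Y) p).
rewrite -(nablaPhiE acm lc oB (sub _ sX) sBW (sub _ sY)) //.
rewrite (c6a B) //; [|exact: sub|exact: sub].
rewrite dotZr dotBr !dotZr -[dot _ (W p) (xi p)]/(eta g xi W p).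
rewrite -[dot _ (W p) (X p)]/(inner g W X p) (innerC acm W X).
by rewrite [eta g xi Y p * _]mulrC subrr.
Qed.
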